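(* Let $\Omega\subset\mathbb{S}^n$ be a domain and let $\rho$ be a differentiable function on $\Omega$. For $t\in\mathbb{R}$, the parallel surface $\Sigma_t(\rho)$ at distance $t$ from $\Sigma(\rho)$ is the surface generated by the function $\rho_t=\rho+t$; more succinctly, $$\Sigma_t(\rho)=\Sigma(\rho_t).$$
   Context: Hyperbolic space $\mathbb{H}^{n+1}$ is the open unit ball in $\mathbb{R}^{n+1}$ with metric $4|dx|^2/(1-|x|^2)^2$; its ideal boundary is the unit sphere $\mathbb{S}^n$. For $\theta\in\mathbb{S}^n$ and $\rho\in\mathbb{R}$, $H(\theta,\rho)$ is the horosphere represented by the Euclidean sphere internally tangent to $\mathbb{S}^n$ at $\theta$, at hyperbolic distance $|\rho|$ from the origin, with $\rho$ positive if the origin is outside the horosphere and negative if it is inside. For a differentiable function $\rho$ on $\Omega$, the surface $\Sigma(\rho)$ generated by $\rho$ is the outer envelope of the family $\{H(\theta,\rho(\theta)):\theta\in\Omega\}$ (the component of the envelope other than $\mathbb{S}^n$), given explicitly as the image of $$R_\rho(\theta)=\frac{|D\rho|^2+(e^{2\rho}-1)}{|D\rho|^2+(e^{\rho}+1)^2}\,\theta+\frac{2D\rho}{|D\rho|^2+(e^\rho+1)^2},\qquad\theta\in\Omega,$$ where $D\rho$ is the gradient of $\rho$ in the round metric of $\mathbb{S}^n$, regarded as a vector in $\mathbb{R}^{n+1}$ tangent to $\mathbb{S}^n$ at $\theta$. This formula defines $\Sigma(\rho)$ also at points where it is not smooth; $\Sigma(\rho)$ need not be smooth. The point $R_\rho(\theta)$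 lies on $H(\theta,\rho(\theta))$. Let $N_\theta$ be the unit vector at $R_\rho(\theta)$ normal to $H(\theta,\rho(\theta))$ and pointing into the horoball it bounds; equivalently $N_\theta=\frac{d}{dt}R_{\rho+t}(\theta)\big|_{t=0}$. At a smooth point $p=R_\rho(\theta)$ of $\Sigma(\rho)$, the surface is tangent to $H(\theta,\rho(\theta))$ and $N_\theta$ is its outward unit normal $N$ at $p$. At a non-smooth point $p$ the surface has no normal vector, and the family $\mathcal{N}_p=\{N_\theta: R_\rho(\theta)=p\}$ plays the role of the ''normal'' vectors to $\Sigma(\rho)$ at $p$. With $\psi^t(p,X)=\exp_p(tX)$, the parallel surface at distance $t$ is $\Sigma_t(\rho)=\{\psi^t(p,N):p\in\Sigma(\rho)\}$, where $N$ is the outward unit normal at smooth points and ranges over $\mathcal{N}_p$ at non-smooth points $p$; that is, it is the set of points $\psi^t(R_\rho(\theta),N_\theta)$, $\theta\in\Omega$. *)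

(* Defs.v *)
From mathcomp Require Import all_boot all_order all_algebra.
From mathcomp Require Import all_classical all_reals all_analysis.
Set Implicit Arguments.
Unset Strict Implicit.
Unset Printing Implicit Defensive.
Import Order.TTheory GRing.Theory Num.Theory.
Import numFieldNormedType.Exports.
Local Open Scope classical_set_scope.
Local Open Scope ring_scope.

Section Euclidean.
Variables (R : realType) (n : nat).
Local Notation V := 'rV[R]_n.+1.
Implicit Types (u v c : V) (r : R).

(* The library norm `|u| on row vectors is the sup norm; it induces the right
   topology, but lengths and angles need the Euclidean structure below. *)
Definition dotv u v : R := \sum_(i < n.+1) u 0 i * v 0 i.
Definition enorm u : R := Num.sqrt (dotv u u).

Definition esphere c r : set V := [set x | enorm (x - c) = r].
Definition eball c r : set V := [set x | enorm (x - c) < r].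
Definition unit_sphere : set V := esphere 0 1.
Definition unit_ball : set V := eball 0 1.

Definition sphere_domain (Omega : set V) : Prop :=
  [/\ Omega !=set0,
      exists2 U : set V, open U & Omega = unit_sphere `&` U
    & connected Omega].

End Euclidean.

Section Riemannian.
Variables (R : realType) (n : nat).
Local Notation V := 'rV[R]_n.+1.
Variables (g : V -> 'M[R]_n.+1) (M : set V).

Definition metric_inner (p u v : V) : R :=
  \sum_(i < n.+1) \sum_(j < n.+1) g p i j * u 0 i * v 0 j.

Definition partial (i : 'I_n.+1) (f : V -> R) (p : V) : R :=
  'D_(delta_mx 0 i) f p.

Definition christoffel (k i j : 'I_n.+1) (p : V) : R :=
  2^-1 * \sum_(l < n.+1) invmx (g p) k l *
    (partial i (fun q => g q j l) p + partial j (fun q => g q i l) p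
     - partial l (fun q => g q i j) p).

(* Complete geodesics: the metric used below is complete, so every geodesic
   extends to the whole line. *)
Definition geodesic (gamma : R -> V) : Prop :=
  forall t : R,
    [/\ M (gamma t), derivable gamma t 1, derivable (derive1 gamma) t 1
      & forall k : 'I_n.+1,
          derive1 (derive1 gamma) t 0 k
          + \sum_(i < n.+1) \sum_(j < n.+1)
              christoffel k i j (gamma t) * derive1 gamma t 0 i * derive1 gamma t 0 j
          = 0].

Definition exp_map (p v : V) : V :=
  xget p [set q | exists gamma : R -> V,
    [/\ geodesic gamma, gamma 0 = p, derive1 gamma 0 = v & gamma 1 = q]].

Definition c1_path (p q : V) (gamma : R -> V) : Prop :=
  [/\ forall t : R, derivable gamma t 1, continuous (derive1 gamma),
      forall t : R, 0 <= t <= 1 -> M (gamma t), gamma 0 = p & gamma 1 = q].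

Definition path_length (gamma : R -> V) : R :=
  \int[@lebesgue_measure R]_(t in `[0, 1])
    Num.sqrt (metric_inner (gamma t) (derive1 gamma t) (derive1 gamma t)).

Definition distance (p q : V) : R :=
  inf [set path_length gamma | gamma in c1_path p q].

Definition distance_to_set (p : V) (A : set V) : R :=
  inf [set distance p q | q in A].

End Riemannian.

Section Hyperbolic.
Variables (R : realType) (n : nat).
Local Notation V := 'rV[R]_n.+1.
Implicit Types (theta p N : V) (rho : V -> R) (s r t : R).

Definition hyp_metric p : 'M[R]_n.+1 := (4 / (1 - dotv p p) ^+ 2)%:M.
Definition hyp_inner : V -> V -> V -> R := metric_inner hyp_metric.
Definition hyp_exp : V -> V -> V := exp_map hyp_metric (@unit_ball R n).
Definition hyp_distance_to_set : V -> set V -> R :=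
  distance_to_set hyp_metric (@unit_ball R n).

(* The sphere of radius r internally tangent to the unit sphere at theta has
   centre (1 - r) theta; the ideal point theta itself is not in the ball. *)
Definition tangent_center theta r : V := (1 - r) *: theta.
Definition tangent_sphere theta r : set V :=
  esphere (tangent_center theta r) r `\ theta.

Definition horo_radius_spec theta s r : Prop :=
  [/\ 0 < r < 1,
      hyp_distance_to_set 0 (tangent_sphere theta r) = `|s|,
      r < enorm (0 - tangent_center theta r) -> 0 < s
    & enorm (0 - tangent_center theta r) < r -> s < 0].

Definition horo_radius theta s : R := xget 0 (horo_radius_spec theta s).
Definition horo_center theta s : V := tangent_center theta (horo_radius theta s).
Definition horosphere theta s : set V := tangent_sphere theta (horo_radius theta s).
Definition horoball theta s : set V :=
  eball (horo_center theta s) (horo_radius theta s).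

Definition horosphere_tangent theta s p : set V :=
  [set w | dotv w (p - horo_center theta s) = 0].

Definition inner_unit_normal theta s p : set V :=
  [set N | [/\ horosphere theta s p,
      hyp_inner p N N = 1,
      forall w, horosphere_tangent theta s p w -> hyp_inner p N w = 0
    & \forall h \near 0^'+, horoball theta s (p + h *: N)]].

(* A function on an open subset of the unit sphere is represented by a function
   on the ambient space of which only the values on that subset matter.  Its
   extension constant along rays carries its differential structure. *)
Definition radial_extension rho : V -> R := fun x => rho ((enorm x)^-1 *: x).
Definition sphere_differentiable rho theta : Prop :=
  differentiable (radial_extension rho) theta.

Definition sphere_gradient rho theta : V :=
  xget 0 [set v | dotv v theta = 0 /\
    forall w, dotv w theta = 0 -> dotv v w = 'D_w (radial_extension rho) theta].

Definition Rmap rho theta : V :=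
  let D := sphere_gradient rho theta in
  let a := dotv D D in
  let d := a + (expR (rho theta) + 1) ^+ 2 in
  ((a + (expR (2 * rho theta) - 1)) / d) *: theta + (2 / d) *: D.

Definition surface (Omega : set V) rho : set V := Rmap rho @` Omega.

Definition surface_normal rho theta : V :=
  xget 0 (inner_unit_normal theta (rho theta) (Rmap rho theta)).

Definition psi t p N : V := hyp_exp p (t *: N).

Definition parallel_surface (Omega : set V) rho t : set V :=
  [set psi t (Rmap rho theta) (surface_normal rho theta) | theta in Omega].

End Hyperbolic.

(* Main.v *)
Require Import Defs.
From mathcomp Require Import all_boot all_order all_algebra.
From mathcomp Require Import all_classical all_reals all_analysis.
From mathcomp Require Import ring lra.
Import Order.TTheory GRing.Theory Num.Theory.
Import numFieldNormedType.Exports.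
Local Open Scope classical_set_scope.
Local Open Scope ring_scope.

(** Adding a constant to [rho] does not change its gradient [D] at [theta], so
    the curve [s |-> Rmap (rho + s) theta] is an explicit curve in the span of
    [theta] and [D].  Writing [x] for [rho theta + s] and [a] for [|D|^2], its
    space coordinates on the hyperboloid are
    [(e^x theta + e^(- x) ((a - 1) theta + 2 D)) / 2], and this is a unit speed
    geodesic.  Its initial velocity is the inner unit normal of the horosphere
    [H(theta, rho theta)] at [Rmap rho theta], so following that normal for time
    [t] leads to [Rmap (rho + t) theta] ([psi_Rmap]).  The equality of the two
    surfaces holds point by point in [theta].

    Turning this into a proof takes three identifications.

    The exponential map is defined as the endpoint of some geodesic with the
    given initial data, so geodesics have to be unique.  The geodesic equation
    of the ball is [x'' = (2 |x'|^2 x - 4 (x . x') x') / (1 - |x|^2)]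
    ([hyp_geodesicP]).  It conserves [K = |x'|^2 / (1 - |x|^2)^2] and becomes
    linear in the hyperboloid coordinates: with [u = 1 / (1 - |x|^2)], both
    [2 u - 1] and [u x] satisfy [f'' = 4 K f].  Uniqueness for this scalar
    equation gives uniqueness of geodesics ([hyp_geodesic_unique]), and the
    explicit curve then computes the exponential map ([hyp_exp_envelope]).

    The horosphere [H(theta, s)] is specified by its distance to the origin.
    Projecting a path on a diameter bounds its length from below, which makes the
    distance from the origin to a point of Euclidean norm [y] equal to
    [ln (1 + y) - ln (1 - y)] ([hyp_distance_origin]).  The point of the tangent
    sphere of radius [r] closest to the origin is [(1 - 2 r) theta], and the
    signs in the specification force [r = 1 / (e^s + 1)] ([horo_radiusE]).

    The inner unit normal of a horosphere at [p] points to the Euclidean centre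
    because the metric is conformal; its length is fixed by the conformal factor
    ([inner_unit_normalE]). *)

Set Implicit Arguments.
Unset Strict Implicit.
Unset Printing Implicit Defensive.

(** * The Euclidean inner product *)

Section DotProduct.
Context {R : realType} {n : nat}.
Implicit Types (u v w e : 'rV[R]_n.+1) (k r : R).

Lemma dotvC u v : dotv u v = dotv v u.
Proof. by apply: eq_bigr => i _; rewrite mulrC. Qed.

Lemma dotvDl u v w : dotv (u + v) w = dotv u w + dotv v w.
Proof. by rewrite -big_split; apply: eq_bigr => i _; rewrite mxE mulrDl. Qed.

Lemma dotvZl k u v : dotv (k *: u) v = k * dotv u v.
Proof. by rewrite mulr_sumr; apply: eq_bigr => i _; rewrite mxE mulrA. Qed.

Lemma dotvDr u v w : dotv u (v + w) = dotv u v + dotv u w.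
Proof. by rewrite dotvC dotvDl !(dotvC u). Qed.

Lemma dotvZr k u v : dotv u (k *: v) = k * dotv u v.
Proof. by rewrite dotvC dotvZl dotvC. Qed.

Lemma dotvNl u v : dotv (- u) v = - dotv u v.
Proof. by rewrite -scaleN1r dotvZl mulN1r. Qed.

Lemma dotvNr u v : dotv u (- v) = - dotv u v.
Proof. by rewrite dotvC dotvNl dotvC. Qed.

Definition dotvE := (dotvDl, dotvDr, dotvNl, dotvNr, dotvZl, dotvZr).

Lemma dotv0l u : dotv 0 u = 0.
Proof. by rewrite -(scale0r 0) dotvZl mul0r. Qed.

Lemma dotv_ge0 u : 0 <= dotv u u.
Proof. by apply: sumr_ge0 => i _; rewrite -expr2 sqr_ge0. Qed.

Lemma dotv_eq0 u : (dotv u u == 0) = (u == 0).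
Proof.
apply/eqP/eqP => [u0|->]; last by rewrite dotv0l.
apply/rowP => i; rewrite mxE; apply/eqP; rewrite -sqrf_eq0 expr2.
by apply/eqP; move/psumr_eq0P : u0; apply=> // j _; rewrite -expr2 sqr_ge0.
Qed.

Lemma enorm_ge0 u : 0 <= enorm u.
Proof. exact: sqrtr_ge0. Qed.

Lemma sqr_enorm u : enorm u ^+ 2 = dotv u u.
Proof. by rewrite sqr_sqrtr // dotv_ge0. Qed.

Lemma enorm_eqP u r : 0 <= r -> enorm u = r <-> dotv u u = r ^+ 2.
Proof.
by move=> r0; split=> [<-|ur]; rewrite ?sqr_enorm // /enorm ur sqrtr_sqr ger0_norm.
Qed.

Lemma enorm_ltP u r : 0 < r -> enorm u < r <-> dotv u u < r ^+ 2.
Proof.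
by move=> r0; rewrite -sqr_enorm ltr_pXn2r ?nnegrE ?enorm_ge0 // ltW.
Qed.

Lemma enormZ k u : enorm (k *: u) = `|k| * enorm u.
Proof.
by rewrite /enorm !dotvE mulrA -expr2 sqrtrM ?sqr_ge0 // sqrtr_sqr.
Qed.

Lemma unit_ballP u : unit_ball u <-> dotv u u < 1.
Proof.
by rewrite /unit_ball /eball /= subr0; rewrite enorm_ltP // expr1n.
Qed.

Lemma unit_sphereP u : unit_sphere u <-> dotv u u = 1.
Proof.
by rewrite /unit_sphere /esphere /= subr0; rewrite enorm_eqP // expr1n.
Qed.

(** Cauchy-Schwarz for a unit vector: the part of [u] orthogonal to [e] has a
    nonnegative square. *)
Lemma dotv_unit_sqr_le u e : dotv e e = 1 -> dotv u e ^+ 2 <= dotv u u.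
Proof.
move=> e1; have := dotv_ge0 (u - dotv u e *: e).
rewrite !dotvE e1 (dotvC e u); lra.
Qed.

Lemma dotv_unit_le u e : dotv e e = 1 -> `|dotv u e| <= enorm u.
Proof.
move=> e1; rewrite -(sqrtr_sqr (dotv u e)).
by rewrite ler_sqrt ?dotv_ge0 // dotv_unit_sqr_le.
Qed.

End DotProduct.

(** * Derivatives of curves and a linear differential equation *)

Section Calculus.
Context {R : realType}.
Implicit Types (f g df dg : R -> R) (t a b : R).

(** The arithmetic rules below are stated for functions in applied form, so that
    their conclusions compose by unification into derivatives of the formulas
    that occur later. *)
Lemma is_derive_add (W : normedModType R) (p q : R -> W) t (u v : W) :
  is_derive t 1 p u -> is_derive t 1 q v ->
  is_derive t 1 (fun s => p s + q s) (u + v).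
Proof. by move=> ? ?; exact: is_deriveD. Qed.

Lemma is_derive_sub (W : normedModType R) (p q : R -> W) t (u v : W) :
  is_derive t 1 p u -> is_derive t 1 q v ->
  is_derive t 1 (fun s => p s - q s) (u - v).
Proof. by move=> ? ?; exact: is_deriveB. Qed.

Lemma is_derive_continuous (W : normedModType R) (p : R -> W) t (v : W) :
  is_derive t 1 p v -> {for t, continuous p}.
Proof.
by case=> pd _; apply/differentiable_continuous/derivable1_diffP.
Qed.

Lemma is_derive_mul f g t a b : is_derive t 1 f a -> is_derive t 1 g b ->
  is_derive t 1 (fun s => f s * g s) (a * g t + f t * b).
Proof.
move=> fa gb; apply: is_derive_eq.
by rewrite addrC /GRing.scale /= mulrC.
Qed.

Lemma is_derive_inv f t a : f t != 0 -> is_derive t 1 f a ->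
  is_derive t 1 (fun s => (f s)^-1) (- a / f t ^+ 2).
Proof.
move=> f0 fa; apply: (is_derive_eq (is_deriveV f0 fa)).
by rewrite /GRing.scale /= mulrC mulrN mulNr.
Qed.

Lemma is_derive_compose f g t a b : is_derive (g t) 1 f a -> is_derive t 1 g b ->
  is_derive t 1 (fun s => f (g s)) (a * b).
Proof. by move=> fa gb; exact: is_derive1_comp. Qed.

Context {n : nat}.
Local Notation V := 'rV[R]_n.+1.
Implicit Types (p q dp dq : R -> V) (u v : V).

Lemma is_derive_rowP p t v :
  is_derive t 1 p v <-> forall k, is_derive t 1 (fun s => p s 0 k) (v 0 k).
Proof.
split=> [[pd pv] k|pk].
  split; first exact: (derivable_mxP p t 1).1.
  by rewrite -pv derive_mx // mxE.
have pd : derivable p t 1.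
  by apply/derivable_mxP => i j; rewrite ord1; apply: ex_derive; exact: pk.
by split=> //; rewrite derive_mx //; apply/rowP => k; rewrite mxE; apply: derive_val.
Qed.

Lemma is_derive_dotv p q t u v : is_derive t 1 p u -> is_derive t 1 q v ->
  is_derive t 1 (fun s => dotv (p s) (q s)) (dotv u (q t) + dotv (p t) v).
Proof.
move=> /is_derive_rowP pu /is_derive_rowP qv.
have := @is_derive_sum R R R n.+1 (fun i s => p s 0 i * q s 0 i) t 1 _
  (fun i => is_derive_mul (pu i) (qv i)).
rewrite big_split /= => H; move: H; congr is_derive.
by apply/funext => s; rewrite fct_sumE.
Qed.

Lemma is_derive_scale f p t a v : is_derive t 1 f a -> is_derive t 1 p v ->
  is_derive t 1 (fun s => f s *: p s) (a *: p t + f t *: v).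
Proof.
move=> fa /is_derive_rowP pv; apply/is_derive_rowP => k.
have := is_derive_mul fa (pv k); rewrite !mxE; congr is_derive.
by apply/funext => s; rewrite mxE.
Qed.

Lemma continuous_dotv p q t : {for t, continuous p} -> {for t, continuous q} ->
  {for t, continuous (fun s => dotv (p s) (q s))}.
Proof.
move=> pt qt; apply: cvg_big => [|i _]; first exact: add_continuous.
apply: cvgM.
  by apply: (@continuous_comp _ _ _ p (fun u => u 0 i)) => //; exact: coord_continuous.
by apply: (@continuous_comp _ _ _ q (fun u => u 0 i)) => //; exact: coord_continuous.
Qed.

(** The equation makes [f t * expR (- r * t)] constant. *)
Lemma linear_first_order_zero r f : (forall t, is_derive t 1 f (r * f t)) ->
  f 0 = 0 -> forall t, f t = 0.
Proof.
move=> fd f0 t.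
have hd (s : R) : is_derive s 1 (fun s : R => f s * expR (- r * s)) 0.
  have e : is_derive s 1 (fun s : R => expR (- r * s)) (expR (- r * s) * (- r)).
    apply: is_derive_compose.
    by apply: is_derive_eq; rewrite /GRing.scale /= mulr1.
  apply: (is_derive_eq (is_derive_mul (fd s) e)).
  ring.
have /= := @is_derive_0_is_cst _ _ t 0 hd.
by rewrite f0 mul0r => /eqP; rewrite mulf_eq0 (gt_eqF (expR_gt0 _)) orbF => /eqP.
Qed.

(** The sign of [k] allows [k = r * r]; then [g - r * f] solves a first order
    equation with rate [- r] and vanishes, which leaves [f' = r * f]. *)
Lemma linear_second_order_zero k f g : 0 <= k ->
  (forall t, is_derive t 1 f (g t)) -> (forall t, is_derive t 1 g (k * f t)) ->
  f 0 = 0 -> g 0 = 0 -> forall t, f t = 0.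
Proof.
move=> k0 fd gd f0 g0; 
have [r rk] : exists r, k = r * r by exists (Num.sqrt k); rewrite -expr2 sqr_sqrtr.
have gE : forall t, g t + - r * f t = 0.
  apply: (@linear_first_order_zero (- r) (fun t => g t + - r * f t)) => [t|];
    last by rewrite f0 g0 mulr0 addr0.
  have rfd := is_derive_mul (is_derive_cst (- r) t 1) (fd t).
  have d := is_derive_add (gd t) rfd.
  apply: (is_derive_eq d).
  rewrite rk /cst; ring.
apply: (linear_first_order_zero (r := r) _ f0) => t.
by apply: (is_derive_eq (fd t)); have := gE t; rewrite mulNr => /subr0_eq.
Qed.

End Calculus.

(** * The geodesic equation of the ball model *)

Section GeodesicEquation.
Context {R : realType} {n : nat}.
Local Notation V := 'rV[R]_n.+1.
Implicit Types (p u v w : V) (gamma : R -> V).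

Lemma hyp_innerE p u v :
  hyp_inner p u v = 4 / (1 - dotv p p) ^+ 2 * dotv u v.
Proof.
rewrite mulr_sumr; apply: eq_bigr => i _.
rewrite (bigD1 i) //= big1 ?addr0 => [|j ji].
  by rewrite !mxE eqxx mulr1n mulrA.
by rewrite !mxE eq_sym (negPf ji) mulr0n !mul0r.
Qed.

(** Reduces directional derivatives of the metric to one real variable. *)
Lemma derive_along_line (f : V -> R) p v :
  'D_v f p = 'D_1 (fun h : R => f (h *: v + p)) 0.
Proof.
rewrite /derive; set g1 := fun h => h^-1 *: _; set g2 := fun h => h^-1 *: _.
suff -> : g1 = g2 by []; apply/funext => h; rewrite /g1 /g2 /=.
by rewrite scale0r add0r addr0 [h *: 1]mulr1.
Qed.

Lemma dotv_delta_mx p i : dotv p (delta_mx 0 i) = p 0 i.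
Proof.
rewrite /dotv (bigD1 i) //= big1 ?addr0 => [|j ji]; rewrite !mxE !eqxx ?mulr1 //=.
by rewrite (negPf ji) mulr0.
Qed.

Lemma partial_hyp_metric p i j l : dotv p p < 1 ->
  partial i (fun q => hyp_metric q j l) p =
  16 * p 0 i / (1 - dotv p p) ^+ 3 * (j == l)%:R.
Proof.
move=> p1; rewrite /partial derive_along_line.
have w0 : 1 - dotv p p != 0 by rewrite subr_eq0 gt_eqF.
set d := delta_mx 0 i.
suff H : is_derive (0 : R) 1 (fun h : R => hyp_metric (h *: d + p) j l)
    (16 * p 0 i / (1 - dotv p p) ^+ 3 * (j == l)%:R) by exact: derive_val.
have ld : is_derive (0 : R) 1 (fun h : R => h *: d + p) d.
  have := is_derive_add (is_derive_scale (is_derive_id (0 : R) 1) (is_derive_cst d (0 : R) 1))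
    (is_derive_cst p (0 : R) 1).
  by rewrite scale1r scaler0 !addr0.
have sd := is_derive_dotv ld ld.
have wd := is_derive_sub (is_derive_cst (1 : R) (0 : R) 1) sd.
have w2d := is_derive_mul wd wd.
have at0 : 0 *: d + p = p by rewrite scale0r add0r.
have id := is_derive_mul (is_derive_mul (is_derive_cst (4 : R) (0 : R) 1)
  (is_derive_inv _ w2d)) (is_derive_cst ((j == l)%:R : R) (0 : R) 1).
move: id; rewrite at0 /cst => /(_ (mulf_neq0 w0 w0)) id.
have -> : (fun h : R => hyp_metric (h *: d + p) j l) =
  (fun h : R => 4 * ((1 - dotv (h *: d + p) (h *: d + p)) *
     (1 - dotv (h *: d + p) (h *: d + p)))^-1 * (j == l)%:R).
  by apply/funext => h; rewrite mxE -expr2 [RHS]mulr_natr.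
apply: (is_derive_eq id).
rewrite (dotvC d) dotv_delta_mx; field; exact: w0.
Qed.

(** The metric is a multiple [phi] of the identity, and
    [(d phi / d x_i) / phi = 4 x_i / (1 - |x|^2)]. *)
Lemma christoffel_hyp_metric p k i j : dotv p p < 1 ->
  christoffel (@hyp_metric R n) k i j p =
  2 / (1 - dotv p p) *
    (p 0 i * (j == k)%:R + p 0 j * (i == k)%:R - p 0 k * (i == j)%:R).
Proof.
move=> p1; have w0 : 1 - dotv p p != 0 by rewrite subr_eq0 gt_eqF.
rewrite /christoffel /hyp_metric invmx_scalar -/(hyp_metric p).
rewrite (bigD1 k) //= big1 ?addr0 => [|l lk]; last first.
  by rewrite mxE eq_sym (negPf lk) mul0r.
rewrite !partial_hyp_metric // mxE eqxx mulr1n; field; exact: w0.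
Qed.

(** The second derivative of a geodesic through [p] with velocity [v]. *)
Definition hyp_acceleration p v : V :=
  (2 * dotv v v / (1 - dotv p p)) *: p - (4 * dotv p v / (1 - dotv p p)) *: v.

Lemma sum_christoffel_hyp_metric p v k : dotv p p < 1 ->
  \sum_(i < n.+1) \sum_(j < n.+1)
    christoffel (@hyp_metric R n) k i j p * v 0 i * v 0 j =
  - hyp_acceleration p v 0 k.
Proof.
move=> p1; have w0 : 1 - dotv p p != 0 by rewrite subr_eq0 gt_eqF.
pose c := 2 / (1 - dotv p p).
have pick (f : 'I_n.+1 -> R) (i : 'I_n.+1) : \sum_j f j * (j == i)%:R = f i.
  rewrite (bigD1 i) //= big1 ?addr0 ?eqxx ?mulr1 // => j /negPf ->.
  by rewrite mulr0.
transitivity (\sum_(i < n.+1)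
    (c * (p 0 i * v 0 i) * v 0 k + (c * v 0 i * dotv p v) * (i == k)%:R
     - c * p 0 k * (v 0 i * v 0 i))).
  apply: eq_bigr => i _.
  rewrite -(pick (fun j => c * (p 0 i * v 0 i) * v 0 j)).
  rewrite /dotv mulr_sumr mulr_suml.
  rewrite -(pick (fun j => c * p 0 k * (v 0 i * v 0 j))) -big_split /= -sumrB.
  by apply: eq_bigr => j _; rewrite christoffel_hyp_metric // (eq_sym i j) -/c; ring.
rewrite sumrB big_split /= pick -mulr_suml -!mulr_sumr -/(dotv p v) -/(dotv v v).
rewrite !mxE /c; field; exact: w0.
Qed.

(** The coordinate equations in vector form, with the velocity as an explicit
    second unknown. *)
Lemma hyp_geodesicP gamma : geodesic (@hyp_metric R n) (@unit_ball R n) gamma <->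
  exists v : R -> V, forall t,
    [/\ dotv (gamma t) (gamma t) < 1, is_derive t 1 gamma (v t)
      & is_derive t 1 v (hyp_acceleration (gamma t) (v t))].
Proof.
split=> [geo|[v vP]].
  exists (derive1 gamma) => t; have [/unit_ballP ball gd vd eqn] := geo t.
  split; [exact: ball | by rewrite derive1E; exact: (derivableP gd) |].
  apply: (is_derive_eq (derivableP vd)).
  rewrite -derive1E; apply/rowP => k; apply/eqP.
  rewrite -subr_eq0 -(sum_christoffel_hyp_metric _ _ ball) eqn //.
have vE : derive1 gamma = v.
  by apply/funext => t; rewrite derive1E; apply: derive_val; have [] := vP t.
move=> t; have [ball gd vd] := vP t; split.
- exact/unit_ballP.
- exact: ex_derive.
- by rewrite vE; exact: ex_derive.
move=> k; rewrite vE sum_christoffel_hyp_metric // derive1E.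
by rewrite (derive_val (f := v)) subrr.
Qed.

End GeodesicEquation.

(** * Uniqueness of geodesics *)

Section Linearisation.
Context {R : realType} {n : nat}.
Local Notation V := 'rV[R]_n.+1.
Context (gamma v : R -> V).
Context (gamma_ball : forall t : R, dotv (gamma t) (gamma t) < 1).
Context (gammaD : forall t : R, is_derive t 1 gamma (v t)).
Context (vD :
  forall t : R, is_derive t 1 v (hyp_acceleration (gamma t) (v t))).

Local Notation w := (fun t => 1 - dotv (gamma t) (gamma t)).

Let w_neq0 t : w t != 0.
Proof. by rewrite subr_eq0 gt_eqF. Qed.

Let wD (t : R) : is_derive t 1 w (- (2 * dotv (gamma t) (v t))).
Proof.
apply: (is_derive_eq (is_derive_sub (is_derive_cst (1 : R) t 1)
  (is_derive_dotv (gammaD t) (gammaD t)))).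
rewrite (dotvC (v t)); ring.
Qed.

Let wwVD (t : R) : is_derive t 1 (fun s : R => (w s * w s)^-1)
  (4 * dotv (gamma t) (v t) / w t ^+ 3).
Proof.
have d := is_derive_inv (f := fun s : R => w s * w s)
  (mulf_neq0 (w_neq0 t) (w_neq0 t)) (is_derive_mul (wD t) (wD t)).
apply: (is_derive_eq d); field; exact: w_neq0.
Qed.

(** A quarter of the squared hyperbolic speed. *)
Definition energy (t : R) := dotv (v t) (v t) / (w t * w t).

Lemma energy_const t : energy t = energy 0.
Proof.
apply: is_derive_0_is_cst => {}t.
have vvD := is_derive_dotv (vD t) (vD t).
have d := is_derive_mul vvD (wwVD t).
apply: (is_derive_eq d).
rewrite /hyp_acceleration !dotvE (dotvC (v t) (gamma t)).
field; exact: w_neq0.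
Qed.

(** On the hyperboloid the point [gamma t] has time coordinate [2 * height t - 1]
    and space coordinates [2 * lift t]. *)
Definition height (t : R) := (w t)^-1.
Definition height_speed (t : R) := 2 * dotv (gamma t) (v t) / (w t * w t).

Lemma heightD (t : R) : is_derive t 1 height (height_speed t).
Proof.
apply: (is_derive_eq (is_derive_inv (w_neq0 t) (wD t))).
by rewrite /height_speed opprK expr2.
Qed.

(** The terms in [(gamma t . v t)^2] cancel, and [|gamma t|^2 = 1 - 1 / height t]
    leaves an expression affine in the height. *)
Lemma height_speedD (t : R) :
  is_derive t 1 height_speed (2 * energy 0 * (2 * height t - 1)).
Proof.
have d := is_derive_mul
  (is_derive_mul (is_derive_cst (2 : R) t 1) (is_derive_dotv (gammaD t) (vD t)))
  (wwVD t).
apply: (is_derive_eq d).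
rewrite -(energy_const t) /energy /height /hyp_acceleration !dotvE /cst.
field; exact: w_neq0.
Qed.

Definition lift (t : R) : V := height t *: gamma t.
Definition lift_speed (t : R) : V := height_speed t *: gamma t + height t *: v t.

Lemma liftD (t : R) : is_derive t 1 lift (lift_speed t).
Proof. exact: is_derive_scale (heightD t) (gammaD t). Qed.

(** The multiples of [v t] cancel, and the constant term of [height_speedD] is
    absorbed by the [gamma t] component of the acceleration. *)
Lemma lift_speedD (t : R) : is_derive t 1 lift_speed ((4 * energy 0) *: lift t).
Proof.
have d := is_derive_add (is_derive_scale (height_speedD t) (gammaD t))
  (is_derive_scale (heightD t) (vD t)).
apply: (is_derive_eq d); apply/rowP => k.
rewrite -(energy_const t) /lift /hyp_acceleration /energy /height_speed /height.
rewrite !mxE; field; exact: w_neq0.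
Qed.

End Linearisation.

Section GeodesicUniqueness.
Context {R : realType} {n : nat}.
Local Notation V := 'rV[R]_n.+1.

(** Equal initial data give equal energies, hence the heights of the two geodesics
    and the coordinates of their lifts solve the same linear equation; the curve
    is recovered as the quotient of the lift by the height. *)
Lemma hyp_geodesic_unique (gamma1 gamma2 : R -> V) :
  geodesic (@hyp_metric R n) (@unit_ball R n) gamma1 ->
  geodesic (@hyp_metric R n) (@unit_ball R n) gamma2 ->
  gamma1 0 = gamma2 0 -> derive1 gamma1 0 = derive1 gamma2 0 ->
  gamma1 = gamma2.
Proof.
move=> /hyp_geodesicP[v1 g1] /hyp_geodesicP[v2 g2] eq0.
have [b1 d1 a1] : [/\ forall t : R, dotv (gamma1 t) (gamma1 t) < 1,
    forall t : R, is_derive t 1 gamma1 (v1 t)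
  & forall t : R, is_derive t 1 v1 (hyp_acceleration (gamma1 t) (v1 t))].
  by split=> t; have [] := g1 t.
have [b2 d2 a2] : [/\ forall t : R, dotv (gamma2 t) (gamma2 t) < 1,
    forall t : R, is_derive t 1 gamma2 (v2 t)
  & forall t : R, is_derive t 1 v2 (hyp_acceleration (gamma2 t) (v2 t))].
  by split=> t; have [] := g2 t.
rewrite !derive1E (derive_val (is_derive := d1 0)) (derive_val (is_derive := d2 0)).
move=> veq0.
have energy_eq : energy gamma1 v1 0 = energy gamma2 v2 0.
  by rewrite /energy eq0 veq0.
have energy_ge0 : 0 <= 4 * energy gamma1 v1 0.
  by rewrite mulr_ge0 // divr_ge0 ?dotv_ge0 // -expr2 sqr_ge0.
have heq t : height gamma1 t = height gamma2 t.
  apply/eqP; rewrite -subr_eq0; apply/eqP; move: t.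
  apply: (linear_second_order_zero (k := 4 * energy gamma1 v1 0)
    (f := fun t => height gamma1 t - height gamma2 t)
    (g := fun t => height_speed gamma1 v1 t - height_speed gamma2 v2 t))
    => // [t|t||].
  - exact: is_derive_sub (heightD b1 d1 t) (heightD b2 d2 t).
  - apply: (is_derive_eq (is_derive_sub (height_speedD b1 d1 a1 t)
      (height_speedD b2 d2 a2 t))).
    rewrite energy_eq; ring.
  - by rewrite /height eq0 subrr.
  - by rewrite /height_speed eq0 veq0 subrr.
have leq t k : lift gamma1 t 0 k = lift gamma2 t 0 k.
  apply/eqP; rewrite -subr_eq0; apply/eqP; move: t.
  apply: (linear_second_order_zero (k := 4 * energy gamma1 v1 0)
    (f := fun t => lift gamma1 t 0 k - lift gamma2 t 0 k)
    (g := fun t => lift_speed gamma1 v1 t 0 k - lift_speed gamma2 v2 t 0 k))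
    => // [t|t||].
  - have /is_derive_rowP/(_ k) e1 := liftD b1 d1 t.
    have /is_derive_rowP/(_ k) e2 := liftD b2 d2 t.
    exact: is_derive_sub e1 e2.
  - have /is_derive_rowP/(_ k) e1 := lift_speedD b1 d1 a1 t.
    have /is_derive_rowP/(_ k) e2 := lift_speedD b2 d2 a2 t.
    apply: (is_derive_eq (is_derive_sub e1 e2)).
    by rewrite -energy_eq !mxE; ring.
  - by rewrite /lift /height eq0 subrr.
  - by rewrite /lift_speed /height /height_speed eq0 veq0 subrr.
apply/funext => t; apply/rowP => k; have := leq t k.
rewrite /lift !mxE -heq; apply: mulfI.
by rewrite invr_eq0 subr_eq0 gt_eqF.
Qed.

Lemma hyp_expE (gamma : R -> V) (v : V) :
  geodesic (@hyp_metric R n) (@unit_ball R n) gamma -> derive1 gamma 0 = v ->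
  hyp_exp (gamma 0) v = gamma 1.
Proof.
move=> geo gv; apply: xget_unique; first by exists gamma.
move=> q [gamma' [geo' g0 gv' <-]].
by rewrite (@hyp_geodesic_unique gamma' gamma) // gv'.
Qed.

End GeodesicUniqueness.

(** * The geodesic normal to a horosphere *)

Section EnvelopeGeodesic.
Context {R : realType} {n : nat}.
Local Notation V := 'rV[R]_n.+1.
Context (theta D : V).
Context (theta1 : dotv theta theta = 1).
Context (D_tangent : dotv D theta = 0).
Implicit Types (s t x : R).

Let a := dotv D D.
Let d s := a + (expR s + 1) ^+ 2.

Let d_neq0 s : d s != 0.
Proof.
by rewrite gt_eqF // ltr_wpDl ?dotv_ge0 // exprn_gt0 // ltr_wpDl ?expR_ge0.
Qed.

Let theta_D : dotv theta D = 0.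
Proof. by rewrite dotvC. Qed.

(** The envelope map as a function of the value [s] of [rho] at [theta], for a
    fixed gradient [D] there. *)
Definition envelope_point s : V :=
  ((a + (expR (2 * s) - 1)) / d s) *: theta + (2 / d s) *: D.

(** The derivative of [x |-> envelope_point (s0 + x * t)], at a point where
    the argument is [s]. *)
Definition envelope_velocity s t : V :=
  (2 * t * expR s * ((expR s + 1) ^+ 2 - a) / d s ^+ 2) *: theta
  - (4 * t * expR s * (expR s + 1) / d s ^+ 2) *: D.

Lemma envelope_point_norm s :
  1 - dotv (envelope_point s) (envelope_point s) = 4 * expR s / d s.
Proof.
rewrite /envelope_point !dotvE theta1 D_tangent theta_D -/a expRM_natl.
move: (d_neq0 s); rewrite /d => d0; field; exact: d0.
Qed.

Lemma envelope_point_ball s : dotv (envelope_point s) (envelope_point s) < 1.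
Proof.
rewrite -subr_gt0 envelope_point_norm divr_gt0 ?mulr_gt0 ?expR_gt0 //.
by rewrite lt_neqAle eq_sym d_neq0 addr_ge0 ?dotv_ge0 ?sqr_ge0.
Qed.

(** With [envelope_point_norm], this says that the hyperbolic speed is [|t|]. *)
Lemma envelope_velocity_norm s t :
  dotv (envelope_velocity s t) (envelope_velocity s t) =
  4 * t ^+ 2 * expR s ^+ 2 / d s ^+ 2.
Proof.
rewrite /envelope_velocity !dotvE theta1 D_tangent theta_D -/a.
move: (d_neq0 s); rewrite /d => d0; field; exact: d0.
Qed.

Lemma envelope_point_velocity s t :
  dotv (envelope_point s) (envelope_velocity s t) =
  - (2 * t * expR s * (a + 1 - expR s ^+ 2) / d s ^+ 2).
Proof.
rewrite /envelope_velocity /envelope_point !dotvE theta1 D_tangent theta_D -/a expRM_natl.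
move: (d_neq0 s); rewrite /d => d0; field; exact: d0.
Qed.

Let expD s t x : is_derive x 1 (fun y : R => expR (s + y * t)) (expR (s + x * t) * t).
Proof.
apply: is_derive_compose.
apply: (is_derive_eq (is_derive_add (is_derive_cst s x 1)
  (is_derive_mul (is_derive_id x 1) (is_derive_cst t x 1)))).
by rewrite /cst; ring.
Qed.

Let dD s t x : is_derive x 1 (fun y : R => d (s + y * t))
  (2 * t * expR (s + x * t) * (expR (s + x * t) + 1)).
Proof.
have e1 := is_derive_add (expD s t x) (is_derive_cst (1 : R) x 1).
apply: (is_derive_eq (is_derive_add (is_derive_cst a x 1) (is_derive_mul e1 e1))).
by rewrite /cst; ring.
Qed.

Let dVD s t x : is_derive x 1 (fun y : R => (d (s + y * t))^-1)
  (- (2 * t * expR (s + x * t) * (expR (s + x * t) + 1)) / d (s + x * t) ^+ 2).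
Proof. exact: (is_derive_inv (f := fun y : R => d (s + y * t)) (d_neq0 _) (dD s t x)). Qed.

Lemma envelope_pointD s t x :
  is_derive x 1 (fun y : R => envelope_point (s + y * t))
    (envelope_velocity (s + x * t) t).
Proof.
rewrite /envelope_point; under eq_fun do rewrite expRM_natl.
have e2 := is_derive_mul (expD s t x) (expD s t x).
have num := is_derive_add (is_derive_cst a x 1)
  (is_derive_sub e2 (is_derive_cst (1 : R) x 1)).
have c2 := is_derive_cst (2 : R) x 1.
have cD := is_derive_cst D x (1 : R).
have ctheta := is_derive_cst theta x (1 : R).
have der := is_derive_add (is_derive_scale (is_derive_mul num (dVD s t x)) ctheta)
  (is_derive_scale (is_derive_mul c2 (dVD s t x)) cD).
apply: (is_derive_eq der); rewrite /envelope_velocity.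
apply/rowP => k; rewrite !mxE /cst.
move: (d_neq0 (s + x * t)); rewrite /d => d0; field; exact: d0.
Qed.

(** The three inner products entering the acceleration have closed forms, so that
    the coefficients of [theta] and [D] on both sides are rational functions of
    [expR (s + x * t)], [|D|^2] and [t]. *)
Lemma envelope_velocityD s t x :
  is_derive x 1 (fun y : R => envelope_velocity (s + y * t) t)
    (hyp_acceleration (envelope_point (s + x * t)) (envelope_velocity (s + x * t) t)).
Proof.
have e1 := is_derive_add (expD s t x) (is_derive_cst (1 : R) x 1).
have e1sq := is_derive_mul e1 e1.
have dV2 := is_derive_mul (dVD s t x) (dVD s t x).
have ctheta := is_derive_cst theta x (1 : R).
have cD := is_derive_cst D x (1 : R).
have ct : forall c, is_derive x 1 (fun y : R => c * t * expR (s + y * t)) _ :=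
  fun c => is_derive_mul (is_derive_cst (c * t) x 1) (expD s t x).
have c1 := is_derive_mul (is_derive_mul (ct 2)
  (is_derive_sub e1sq (is_derive_cst a x 1))) dV2.
have c2 := is_derive_mul (is_derive_mul (ct 4) e1) dV2.
have der := is_derive_sub (is_derive_scale c1 ctheta) (is_derive_scale c2 cD).
(* Products instead of squares, to match the shape of the composed derivative. *)
have -> : (fun y : R => envelope_velocity (s + y * t) t) = fun y : R =>
    (2 * t * expR (s + y * t) * ((expR (s + y * t) + 1) * (expR (s + y * t) + 1) - a)
       * ((d (s + y * t))^-1 * (d (s + y * t))^-1)) *: theta
    - (4 * t * expR (s + y * t) * (expR (s + y * t) + 1)
       * ((d (s + y * t))^-1 * (d (s + y * t))^-1)) *: D.
  by apply/funext => y; rewrite /envelope_velocity -!expr2 !exprVn.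
apply: (is_derive_eq der).
rewrite /hyp_acceleration envelope_point_norm envelope_velocity_norm.
rewrite envelope_point_velocity /envelope_velocity /envelope_point expRM_natl.
have E0 : expR (s + x * t) != 0 by rewrite gt_eqF ?expR_gt0.
apply/rowP => k; rewrite !mxE /cst.
move: (d_neq0 (s + x * t)); rewrite /d => d0.
by field; rewrite E0 d0.
Qed.

Lemma envelope_geodesic s t :
  geodesic (@hyp_metric R n) (@unit_ball R n) (fun x => envelope_point (s + x * t)).
Proof.
apply/hyp_geodesicP; exists (fun x => envelope_velocity (s + x * t) t) => x.
split; [exact: envelope_point_ball | exact: envelope_pointD |].
exact: envelope_velocityD.
Qed.

Lemma hyp_exp_envelope s t :
  hyp_exp (envelope_point s) (envelope_velocity s t) = envelope_point (s + t).
Proof.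
have v0 : derive1 (fun x => envelope_point (s + x * t)) 0 = envelope_velocity s t.
  rewrite derive1E (derive_val (is_derive := envelope_pointD s t 0)).
  by rewrite mul0r addr0.
have := hyp_expE (envelope_geodesic s t) v0.
by rewrite mul0r addr0 mul1r.
Qed.

End EnvelopeGeodesic.

(** * The inner unit normal of a horosphere *)

Section InnerNormal.
Context {R : realType} {n : nat}.
Local Notation V := 'rV[R]_n.+1.
Implicit Types (theta p N : V) (s r : R).

(** Orthogonality to the tangent space leaves the multiples [mu (p - c)], where [c]
    is the centre; the norm fixes [mu] up to sign, and a small step along the
    vector enters the horoball exactly when [mu] is negative. *)
Lemma inner_unit_normalE theta s p :
  0 < horo_radius theta s -> horosphere theta s p -> dotv p p < 1 ->
  xget 0 (inner_unit_normal theta s p) =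
  ((1 - dotv p p) / (2 * horo_radius theta s)) *: (horo_center theta s - p).
Proof.
set r := horo_radius theta s => r0 ps p1.
set c := horo_center theta s; set w := 1 - dotv p p.
have w0 : 0 < w by rewrite subr_gt0.
have w0' : w != 0 by rewrite gt_eqF.
have r0' : r != 0 by rewrite gt_eqF.
have [m mE] : exists m, p - c = m by exists (p - c).
pose k := w / (2 * r).
have k0 : 0 < k by rewrite divr_gt0 // mulr_gt0.
have mm : dotv m m = r ^+ 2.
  by rewrite -mE; have [+ _] := ps; rewrite /esphere /= enorm_eqP // ltW.
have inner u v : hyp_inner p u v = 4 / w ^+ 2 * dotv u v by exact: hyp_innerE.
have coef0 : 4 / w ^+ 2 != 0 by rewrite mulf_neq0 // invr_eq0 expf_neq0.
have tangentP v : horosphere_tangent theta s p v <-> dotv v m = 0 by rewrite -mE.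
have in_horoball mu h : horoball theta s (p + h *: (mu *: m)) <->
    (1 + h * mu) ^+ 2 < 1.
  rewrite /horoball /eball -/c -/r /= enorm_ltP //.
  have -> : p + h *: (mu *: m) - c = (1 + h * mu) *: m.
    by rewrite scalerDl scale1r scalerA addrAC mE.
  by rewrite !dotvE mm mulrA -expr2 gtr_pMl // exprn_gt0.
have -> : k *: (c - p) = (- k) *: m by rewrite scaleNr -scalerN -mE opprB.
apply: xget_unique; first split=> //.
- rewrite inner !dotvE mm /k; field; by rewrite w0' r0'.
- move=> v /tangentP vm; rewrite inner dotvC.
  by rewrite !dotvE vm !mulr0.
- near=> h; apply/in_horoball.
  have h0 : 0 < h by near: h; exact: nbhs_right_gt.
  have hk : h < k^-1 by near: h; apply: nbhs_right_lt; rewrite invr_gt0.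
  have kh1 : h * k < 1 by rewrite -ltr_pdivlMr // mul1r.
  have kh0 : 0 < h * k by rewrite mulr_gt0.
  nra.
move=> N [_ N1 Northo Nin].
(* The component of [N] orthogonal to [m] is tangent, hence orthogonal to [N]. *)
pose mu := dotv N m / r ^+ 2.
have rest : dotv (N - mu *: m) m = 0.
  by rewrite !dotvE mm /mu divfK ?subrr // expf_neq0.
have NE : N = mu *: m.
  apply/eqP; rewrite -subr_eq0 -dotv_eq0.
  have := Northo _ ((tangentP _).2 rest); rewrite inner => /eqP.
  rewrite mulf_eq0 (negPf coef0) /= => /eqP Nrest.
  by rewrite dotvDl Nrest add0r dotvNl dotvZl (dotvC m) rest mulr0 oppr0.
have mu0 : mu < 0.
  have [h [h0 /=]] : exists h : R, 0 < h /\ horoball theta s (p + h *: N).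
    have := filter_ex (filterI Nin (nbhs_right_gt (0 : R))).
    by move=> [h [hin h0]]; exists h.
  rewrite NE in_horoball => hin.
  have : h * mu < 0 by nra.
  by rewrite pmulr_rlt0.
rewrite NE; congr (_ *: m).
have : mu ^+ 2 = k ^+ 2.
  move: N1; rewrite NE inner !dotvE mm => e.
  have : 4 / w ^+ 2 * (mu ^+ 2 * r ^+ 2) = 1 by apply: etrans e; ring.
  rewrite /k => e'.
  have -> : mu ^+ 2 = (4 / w ^+ 2 * (mu ^+ 2 * r ^+ 2)) * (w / (2 * r)) ^+ 2.
    by field; rewrite w0' r0'.
  by rewrite e' mul1r.
move=> /eqP; rewrite eqf_sqr => /orP[] /eqP // muk.
by move: mu0; rewrite muk ltNge ltW.
Unshelve. all: by end_near. Qed.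

End InnerNormal.

(** * Hyperbolic length along a diameter *)

Section RadialDistance.
Context {R : realType}.
Implicit Types (x y t : R) (f df : R -> R).

(** Twice the inverse hyperbolic tangent: the signed hyperbolic distance from the
    origin of the point at [y] on a diameter. *)
Definition radial_distance y := ln (1 + y) - ln (1 - y).

Lemma radial_distance0 : radial_distance 0 = 0.
Proof. by rewrite /radial_distance addr0 subr0 subrr. Qed.

Lemma radial_distanceN y : radial_distance (- y) = - radial_distance y.
Proof. by rewrite /radial_distance opprK opprB. Qed.

Lemma radial_distance_mono x y : `|x| < 1 -> `|y| < 1 ->
  (radial_distance x <= radial_distance y) = (x <= y).
Proof.
rewrite !ltr_norml => /andP[x1 x2] /andP[y1 y2].
have ler a b : -1 < a -> a < 1 -> -1 < b -> b < 1 -> a <= b ->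
    radial_distance a <= radial_distance b.
  by move=> *; rewrite lerB // ler_ln ?posrE; lra.
have [xy|yx] := leP x y; first by rewrite ler.
apply/negbTE; rewrite -ltNge /radial_distance ltrB //.
  by rewrite ltr_ln ?posrE; lra.
by rewrite ltr_ln ?posrE; lra.
Qed.

Lemma radial_distance_inj x y : `|x| < 1 -> `|y| < 1 ->
  radial_distance x = radial_distance y -> x = y.
Proof.
move=> x1 y1 /eqP; rewrite eq_le !radial_distance_mono // -eq_le.
by move/eqP.
Qed.

Lemma radial_distance_norm y : `|y| < 1 ->
  radial_distance `|y| = `|radial_distance y|.
Proof.
move=> y1; have n0 : `|0 : R| < 1 by rewrite normr0.
have [y0|y0] := leP 0 y.
  by rewrite !ger0_norm // -radial_distance0 radial_distance_mono.
rewrite (ltr0_norm y0) radial_distanceN ler0_norm //.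
by rewrite -radial_distance0 radial_distance_mono // ltW.
Qed.

Lemma radial_distance_expR s :
  radial_distance ((expR s - 1) / (expR s + 1)) = s.
Proof.
have E0 := expR_gt0 s; have E1 : expR s + 1 != 0 by rewrite gt_eqF ?addr_gt0.
have num : 1 + (expR s - 1) / (expR s + 1) = 2 * expR s / (expR s + 1) by field.
have den : 1 - (expR s - 1) / (expR s + 1) = 2 / (expR s + 1) by field.
rewrite /radial_distance num den -ln_div ?posrE ?divr_gt0 ?mulr_gt0 ?addr_gt0 //.
by rewrite -[RHS]expRK; congr ln; field.
Qed.

Lemma radial_distanceD y : `|y| < 1 ->
  is_derive y 1 radial_distance (2 / (1 - y ^+ 2)).
Proof.
rewrite ltr_norml => /andP[y1 y2].
have p1 : 0 < 1 + y by lra.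
have p2 : 0 < 1 - y by lra.
have d1 := is_derive_compose (f := @ln R) (g := fun x : R => 1 + x)
  (is_derive1_ln p1)
  (is_derive_add (is_derive_cst (1 : R) y 1) (is_derive_id y 1)).
have d2 := is_derive_compose (f := @ln R) (g := fun x : R => 1 - x)
  (is_derive1_ln p2)
  (is_derive_sub (is_derive_cst (1 : R) y 1) (is_derive_id y 1)).
apply: (is_derive_eq (is_derive_sub d1 d2)).
have -> : 1 - y ^+ 2 = (1 + y) * (1 - y) by ring.
by field; rewrite !gt_eqF.
Qed.

(** The integrand is the derivative of the radial distance of [f t]. *)
Lemma integral_radial_speed f df :
  (forall t : R, is_derive t 1 f (df t)) -> continuous df ->
  (forall t, 0 <= t <= 1 -> `|f t| < 1) ->
  let g t := 2 * df t / (1 - f t ^+ 2) in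
  (@lebesgue_measure R).-integrable `[0, 1] (EFin \o g) /\
  \int[@lebesgue_measure R]_(t in `[0, 1]) g t =
  radial_distance (f 1) - radial_distance (f 0).
Proof.
move=> fd dfc f1 g.
have f2 t : 0 <= t <= 1 -> 1 - f t ^+ 2 != 0.
  move=> /f1; rewrite ltr_norml => /andP[a b].
  by rewrite gt_eqF //; nra.
have Fd t : 0 <= t <= 1 -> is_derive t 1 (fun s => radial_distance (f s)) (g t).
  move=> t01; apply: (is_derive_eq (is_derive_compose (radial_distanceD (f1 t t01)) (fd t))).
  by rewrite /g mulrAC.
have gc : {within `[0, 1], continuous g}.
  apply: continuous_in_subspaceT => t; rewrite inE /= in_itv /= => t01.
  apply: cvgM; first by apply: cvgM; [exact: cvg_cst | exact: dfc].
  apply: cvgV; first exact: f2.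
  apply: cvgB; first exact: cvg_cst.
  by apply: cvgM; exact: (is_derive_continuous (fd t)).
split; first by apply: continuous_compact_integrable => //; exact: segment_compact.
rewrite /Rintegral (@continuous_FTC2 _ g (fun s => radial_distance (f s))) //.
- split.
  + move=> t /[!in_itv] /= /andP[t0 t1].
    by apply: ex_derive; apply: Fd; rewrite !ltW.
  + apply: cvg_at_right_filter; apply: (is_derive_continuous (Fd 0 _)).
    by rewrite lexx ler01.
  + apply: cvg_at_left_filter; apply: (is_derive_continuous (Fd 1 _)).
    by rewrite lexx ler01.
- move=> t /[!in_itv] /= /andP[t0 t1].
  have t01 : 0 <= t <= 1 by rewrite !ltW.
  by rewrite derive1E (derive_val (is_derive := Fd t t01)).
Qed.

End RadialDistance.

(** * Distance from the origin and the radius of a horosphere *)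

Section DistanceFromOrigin.
Context {R : realType} {n : nat}.
Local Notation V := 'rV[R]_n.+1.
Implicit Types (p q v e theta : V) (gamma : R -> V) (r s t : R).

Lemma hyp_speedE p v : dotv p p < 1 ->
  Num.sqrt (metric_inner (@hyp_metric R n) p v v) = 2 * enorm v / (1 - dotv p p).
Proof.
move=> p1; have w0 : 0 < 1 - dotv p p by rewrite subr_gt0.
rewrite -/(hyp_inner p v v) hyp_innerE -(sqr_enorm v).
have -> : 4 / (1 - dotv p p) ^+ 2 * enorm v ^+ 2 =
    (2 * enorm v / (1 - dotv p p)) ^+ 2 by field; rewrite gt_eqF.
by rewrite sqrtr_sqr ger0_norm // divr_ge0 ?mulr_ge0 ?enorm_ge0 // ltW.
Qed.

(** Projecting a path on the line of a unit vector [e] does not increase its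
    length, because the conformal factor grows with the norm; the projected path
    lies on a diameter, where lengths are explicit. *)
Lemma path_length_ge q e gamma : dotv e e = 1 ->
  c1_path (@unit_ball R n) 0 q gamma ->
  radial_distance (dotv q e) <= path_length (@hyp_metric R n) gamma.
Proof.
move=> e1 [gd vc ball g0 g1].
have {}ball t : 0 <= t <= 1 -> dotv (gamma t) (gamma t) < 1.
  by move=> /ball /unit_ballP.
have gD (t : R) : is_derive t 1 gamma (derive1 gamma t).
  by rewrite derive1E; exact: derivableP.
pose f t := dotv (gamma t) e; pose df t := dotv (derive1 gamma t) e.
have fd (t : R) : is_derive t 1 f (df t).
  apply: (is_derive_eq (is_derive_dotv (gD t) (is_derive_cst e t (1 : R)))).
  by rewrite (dotvC _ 0) dotv0l addr0.
have dfc : continuous df.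
  by move=> t; apply: (continuous_dotv (vc t)); exact: cvg_cst.
have f2 t : f t ^+ 2 <= dotv (gamma t) (gamma t) by exact: dotv_unit_sqr_le.
have f1 t : 0 <= t <= 1 -> `|f t| < 1.
  move=> /ball b; rewrite -(@ltr_pXn2r _ 2) ?nnegrE // expr1n.
  by rewrite real_normK ?num_real // (le_lt_trans (f2 t)).
have [fi fI] := integral_radial_speed fd dfc f1.
have -> : radial_distance (dotv q e) = radial_distance (f 1) - radial_distance (f 0).
  by rewrite /f g0 g1 dotv0l radial_distance0 subr0.
rewrite -fI; apply: le_Rintegral => //.
  apply: continuous_compact_integrable; first exact: segment_compact.
  apply: continuous_in_subspaceT => t; rewrite inE /= in_itv /= => t01.
  have -> : (fun t => Num.sqrt (metric_inner (@hyp_metric R n) (gamma t)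
        (derive1 gamma t) (derive1 gamma t))) =
      fun t => Num.sqrt (4 / (1 - dotv (gamma t) (gamma t)) ^+ 2
        * dotv (derive1 gamma t) (derive1 gamma t)).
    by apply/funext => s; rewrite -hyp_innerE.
  have gc := is_derive_continuous (gD t).
  have ballc : {for t, continuous (fun s => 1 - dotv (gamma s) (gamma s))}.
    by apply: cvgB; [exact: cvg_cst | exact: continuous_dotv].
  have sc : {for t, continuous (fun s => 4 / (1 - dotv (gamma s) (gamma s)) ^+ 2
      * dotv (derive1 gamma s) (derive1 gamma s))}.
    apply: cvgM; last exact: (continuous_dotv (vc t) (vc t)).
    apply: cvgM; first exact: cvg_cst.
    apply: cvgV; first by rewrite expf_neq0 // subr_eq0 gt_eqF // ball.
    exact: (cvgM ballc ballc).
  exact: (continuous_comp sc (@sqrt_continuous R _)).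
move=> t /=; rewrite in_itv /= => t01; have b := ball t t01.
have w0 : 0 < 1 - dotv (gamma t) (gamma t) by rewrite subr_gt0.
have wf : 1 - dotv (gamma t) (gamma t) <= 1 - f t ^+ 2 by rewrite lerB.
have wf0 := lt_le_trans w0 wf.
rewrite hyp_speedE //.
apply: (@le_trans _ _ (2 * enorm (derive1 gamma t) / (1 - f t ^+ 2))).
  rewrite ler_pM2r ?invr_gt0 // ler_pM2l //.
  exact: le_trans (ler_norm _) (dotv_unit_le _ e1).
by rewrite ler_wpM2l ?mulr_ge0 ?enorm_ge0 // lef_pV2 ?posrE.
Qed.

(** The straight segment attains the lower bound of [path_length_ge]. *)
Lemma path_length_segment q : dotv q q < 1 ->
  c1_path (@unit_ball R n) 0 q (fun t => t *: q) /\
  path_length (@hyp_metric R n) (fun t => t *: q) = radial_distance (enorm q).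
Proof.
move=> q1.
have gD (t : R) : is_derive t 1 (fun t : R => t *: q) q.
  apply: (is_derive_eq (is_derive_scale (is_derive_id t (1 : R)) (is_derive_cst q t (1 : R)))).
  by rewrite scale1r scaler0 addr0.
have vE : derive1 (fun t : R => t *: q) = cst q.
  by apply/funext => t; rewrite derive1E (derive_val (is_derive := gD t)).
have ball t : 0 <= t <= 1 -> dotv (t *: q) (t *: q) < 1.
  move=> /andP[t0 t1]; rewrite !dotvE mulrA -expr2.
  by apply: le_lt_trans q1; rewrite ler_piMl ?dotv_ge0 // exprn_ile1.
split.
  split.
  - by move=> t; case: (gD t) => gd _; exact: gd.
  - by rewrite vE => t; exact: cvg_cst.
  - by move=> t /ball /unit_ballP.
  - by rewrite scale0r.
  - by rewrite scale1r.
have fd (t : R) : is_derive t 1 (fun t : R => t * enorm q) (cst (enorm q) t).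
  apply: (is_derive_eq
    (is_derive_mul (is_derive_id t (1 : R)) (is_derive_cst (enorm q) t (1 : R)))).
  by rewrite /cst mul1r mulr0 addr0.
have f1 t : 0 <= t <= 1 -> `|t * enorm q| < 1.
  move=> t01; have := ball t t01; rewrite -sqr_enorm enormZ => b.
  rewrite normrM (ger0_norm (enorm_ge0 q)).
  by rewrite -(@ltr_pXn2r _ 2) ?nnegrE ?mulr_ge0 ?enorm_ge0 // expr1n.
have [_ ] := integral_radial_speed fd (fun t => cvg_cst _) f1.
rewrite mul1r mul0r radial_distance0 subr0 => <-.
apply: eq_Rintegral => t; rewrite inE /= in_itv /= => t01.
rewrite vE hyp_speedE ?ball // !dotvE exprMn sqr_enorm.
by rewrite mulrA -expr2.
Qed.

Lemma inf_min (A : set R) m : A m -> lbound A m -> inf A = m.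
Proof.
move=> Am lbm; apply/eqP; rewrite eq_le lb_le_inf //; last by exists m.
by rewrite ge_inf //; exists m.
Qed.

Lemma hyp_distance_origin q : dotv q q < 1 ->
  distance (@hyp_metric R n) (@unit_ball R n) 0 q = radial_distance (enorm q).
Proof.
move=> q1; have [seg seglen] := path_length_segment q1.
apply: inf_min; first by exists (fun t => t *: q).
move=> _ [gamma path <-].
have [->|q0] := eqVneq q 0.
  rewrite /enorm dotv0l sqrtr0 radial_distance0.
  by apply: Rintegral_ge0 => t _; exact: sqrtr_ge0.
have nq0 : enorm q != 0 by rewrite -sqrf_eq0 sqr_enorm dotv_eq0.
have e1 : dotv ((enorm q)^-1 *: q) ((enorm q)^-1 *: q) = 1.
  by rewrite !dotvE -sqr_enorm; field.
have := path_length_ge e1 path.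
by rewrite dotvE -sqr_enorm expr2 mulKf.
Qed.

Lemma horo_vertexP theta r : dotv theta theta = 1 -> 0 < r < 1 ->
  tangent_sphere theta r ((1 - 2 * r) *: theta).
Proof.
move=> th1 /andP[r0 r1]; split.
  apply/(enorm_eqP _ (ltW r0)).
  rewrite /tangent_center -scalerBl !dotvE th1; ring.
move=> /= th; have : dotv ((1 - 2 * r) *: theta) theta = 1 by rewrite th.
by rewrite dotvE th1 => e; lra.
Qed.

(** Put [y = |q|] and [m = q . theta], so that [y^2 + (1 - 2 r) = 2 (1 - r) m] on
    the sphere.  From [|m| <= y] the quadratics [(y - 1) (y - (1 - 2 r))] and
    [(y + 1) (y + (1 - 2 r))] are respectively nonpositive and nonnegative, which
    locates [y]; the value [y = 1] forces [m = 1] and [q = theta]. *)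
Lemma tangent_sphere_norm theta r q : dotv theta theta = 1 -> 0 < r < 1 ->
  tangent_sphere theta r q -> `|1 - 2 * r| <= enorm q < 1.
Proof.
move=> th1 /andP[r0 r1] [/(enorm_eqP _ (ltW r0)) eqn qth].
rewrite /tangent_center !dotvE th1 in eqn.
have := dotv_unit_le q th1; rewrite ler_norml => /andP[m1 m2].
rewrite (dotvC theta) -sqr_enorm in eqn.
set m := dotv q theta in eqn m1 m2 *; have y0 := enorm_ge0 q.
set y := enorm q in eqn m1 m2 y0 *.
have eqn' : y ^+ 2 + (1 - 2 * r) = 2 * (1 - r) * m by lra.
have y1 : y <= 1.
  rewrite leNgt; apply/negP => y1.
  have : (y - 1) * (y - (1 - 2 * r)) <= 0 by nra.
  by apply/negP; rewrite -ltNge mulr_gt0 //; lra.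
have y_neq1 : y != 1.
  apply/eqP => ye; apply: qth; apply/eqP; rewrite -subr_eq0 -dotv_eq0.
  rewrite !dotvE th1 (dotvC theta) -sqr_enorm -/m -/y ye.
  rewrite ye in eqn'.
  have : (1 - r) * (1 - m) = 0 by lra.
  by move/eqP; rewrite mulf_eq0 => /orP[] /eqP ?; apply/eqP; lra.
apply/andP; split; last by rewrite lt_neqAle y_neq1.
have yr : 0 < y + 1 by lra.
rewrite ler_norml; apply/andP; split.
  have : 0 <= (y + 1) * (y + (1 - 2 * r)) by nra.
  by rewrite pmulr_rge0 //; lra.
have : (y - 1) * (y - (1 - 2 * r)) <= 0 by nra.
by rewrite nmulr_rle0 ?subr_lt0 ?lt_neqAle ?y_neq1 //; lra.
Qed.

Lemma hyp_distance_tangent_sphere theta r : dotv theta theta = 1 -> 0 < r < 1 ->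
  hyp_distance_to_set 0 (tangent_sphere theta r) = `|radial_distance (1 - 2 * r)|.
Proof.
move=> th1 r01.
have en : enorm ((1 - 2 * r) *: theta) = `|1 - 2 * r|.
  by rewrite enormZ /enorm th1 sqrtr1 mulr1.
have vertex := horo_vertexP th1 r01.
have /andP[_ v1] := tangent_sphere_norm th1 r01 vertex.
have n1 : `|1 - 2 * r| < 1 by rewrite -en.
have ball q : tangent_sphere theta r q -> dotv q q < 1.
  move=> /(tangent_sphere_norm th1 r01) /andP[_].
  by rewrite enorm_ltP // expr1n.
rewrite -radial_distance_norm //; apply: inf_min.
  by exists ((1 - 2 * r) *: theta) => //; rewrite hyp_distance_origin ?en //; exact: ball.
move=> _ [q qs <-]; rewrite hyp_distance_origin; last exact: ball.
have /andP[q0 q1] := tangent_sphere_norm th1 r01 qs.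
by rewrite radial_distance_mono ?normr_id // ger0_norm ?enorm_ge0.
Qed.

(** The distance determines [radial_distance (1 - 2 r)] up to sign, and the
    position of the origin determines the sign, so [radial_distance (1 - 2 r) = s]
    and [1 - 2 r = tanh (s / 2)]. *)
Lemma horo_radiusE theta s : dotv theta theta = 1 ->
  horo_radius theta s = (expR s + 1)^-1.
Proof.
move=> th1; have E0 := expR_gt0 s.
have E1 : 1 < expR s + 1 by lra.
have E10 : expR s + 1 != 0 by rewrite gt_eqF // (lt_trans ltr01).
set r0 := (expR s + 1)^-1.
have r001 : 0 < r0 < 1 by rewrite invr_gt0 (lt_trans ltr01) //= invf_lt1 // (lt_trans ltr01).
have c_norm r : 0 < r < 1 -> enorm (0 - tangent_center theta r) = 1 - r.
  move=> /andP[a b]; rewrite sub0r -scaleNr enormZ /enorm th1 sqrtr1 mulr1.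
  by rewrite normrN ger0_norm // subr_ge0 ltW.
have diam r : 0 < r < 1 -> `|1 - 2 * r| < 1.
  by move=> /andP[a b]; rewrite ltr_norml; apply/andP; split; lra.
have r0s : radial_distance (1 - 2 * r0) = s.
  rewrite -[RHS]radial_distance_expR; congr radial_distance; rewrite /r0; by field.
have zero1 : `|0 : R| < 1 by rewrite normr0.
apply: xget_unique.
  split=> //; first by rewrite hyp_distance_tangent_sphere // r0s.
  - rewrite c_norm // => lt; rewrite ltNge -r0s -radial_distance0.
    by rewrite radial_distance_mono ?diam // -ltNge; lra.
  - rewrite c_norm // => lt; rewrite ltNge -r0s -radial_distance0.
    by rewrite radial_distance_mono ?diam // -ltNge; lra.
move=> r [r01 + pos neg]; rewrite hyp_distance_tangent_sphere // => dist.
rewrite c_norm // in pos neg.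
suff : radial_distance (1 - 2 * r) = s.
  rewrite -r0s => /radial_distance_inj; rewrite !diam // => /(_ isT isT).
  by move=> e; lra.
have sgn (x : R) : `|x| < 1 -> (0 <= radial_distance x) = (0 <= x).
  by move=> x1; have := radial_distance_mono zero1 x1; rewrite radial_distance0.
have sgn' (x : R) : `|x| < 1 -> (radial_distance x <= 0) = (x <= 0).
  by move=> x1; have := radial_distance_mono x1 zero1; rewrite radial_distance0.
have [lt|gt|eq] := ltgtP r (1 - r).
- have F0 : 0 <= radial_distance (1 - 2 * r) by rewrite sgn ?diam //; lra.
  by move: dist; rewrite (ger0_norm F0) (gtr0_norm (pos lt)).
- have F0 : radial_distance (1 - 2 * r) <= 0 by rewrite sgn' ?diam //; lra.
  by move: dist; rewrite (ler0_norm F0) (ltr0_norm (neg gt)) => /oppr_inj.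
- have e : 1 - 2 * r = 0 by lra.
  by move: dist; rewrite e radial_distance0 normr0 => /esym /eqP; rewrite normr_eq0 => /eqP.
Qed.

End DistanceFromOrigin.

(** * Parallel surfaces *)

Section ParallelSurface.
Context {R : realType} {n : nat}.
Local Notation V := 'rV[R]_n.+1.
Implicit Types (theta D : V) (rho : V -> R) (s t : R).

Lemma envelope_point_horosphere theta D s :
  dotv theta theta = 1 -> dotv D theta = 0 ->
  horosphere theta s (envelope_point theta D s).
Proof.
move=> th1 Dth; have thD : dotv theta D = 0 by rewrite dotvC.
have E0 := expR_gt0 s; have E1 : 0 < expR s + 1 by rewrite addr_gt0.
have d0 : dotv D D + (expR s + 1) ^+ 2 != 0.
  by rewrite gt_eqF // ltr_wpDl ?dotv_ge0 // exprn_gt0.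
have r0 : 0 <= (expR s + 1)^-1 by rewrite invr_ge0 ltW.
rewrite /horosphere horo_radiusE //; split; last first.
  move=> /= pth; have := envelope_point_ball th1 Dth s.
  by rewrite pth th1 ltxx.
apply/(enorm_eqP _ r0); rewrite /tangent_center /envelope_point.
rewrite expRM_natl !dotvE th1 Dth thD.
by field; rewrite d0 gt_eqF.
Qed.

(** The explicit geodesic of parameter speed [t] leaves the horosphere along its
    inner normal. *)
Lemma scaled_normal_envelope theta D s t :
  dotv theta theta = 1 -> dotv D theta = 0 ->
  t *: xget 0 (inner_unit_normal theta s (envelope_point theta D s)) =
  envelope_velocity theta D s t.
Proof.
move=> th1 Dth.
have E0 := expR_gt0 s; have E1 : 0 < expR s + 1 by rewrite addr_gt0.
have d0 : dotv D D + (expR s + 1) ^+ 2 != 0.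
  by rewrite gt_eqF // ltr_wpDl ?dotv_ge0 // exprn_gt0.
rewrite inner_unit_normalE; first last.
- exact: envelope_point_ball.
- exact: envelope_point_horosphere.
- by rewrite horo_radiusE // invr_gt0.
rewrite envelope_point_norm // /horo_center horo_radiusE //.
rewrite /tangent_center /envelope_point /envelope_velocity.
rewrite expRM_natl; apply/rowP => k; rewrite !mxE.
by field; rewrite d0 gt_eqF.
Qed.

(** True also where no gradient exists, since the default value is [0]. *)
Lemma sphere_gradient_tangent rho theta : dotv (sphere_gradient rho theta) theta = 0.
Proof.
rewrite /sphere_gradient; case: xgetP => [v -> []//|_]; exact: dotv0l.
Qed.

(** The difference quotients of [rho + t] and [rho] are the same. *)
Lemma sphere_gradientD rho t theta :
  sphere_gradient (fun x => rho x + t) theta = sphere_gradient rho theta.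
Proof.
rewrite /sphere_gradient; congr (xget 0 _).
suff dE (w : V) : 'D_w (radial_extension (fun x => rho x + t)) theta =
    'D_w (radial_extension rho) theta.
  by apply/seteqP; split=> v [v0 vw]; split=> // w /vw ->.
rewrite /derive; set f := (fun h => _); set g := (fun h => _).
suff -> : f = g by []; apply/funext => h; rewrite /f /g /=.
by rewrite /radial_extension opprD addrACA subrr addr0.
Qed.

Lemma psi_Rmap rho theta t : dotv theta theta = 1 ->
  psi t (Rmap rho theta) (surface_normal rho theta) =
  Rmap (fun x => rho x + t) theta.
Proof.
move=> th1; have Dth := sphere_gradient_tangent rho theta.
rewrite /Rmap sphere_gradientD -/(envelope_point theta _ (rho theta + t)).
rewrite /psi /surface_normal /Rmap -/(envelope_point theta _ (rho theta)).
by rewrite scaled_normal_envelope // hyp_exp_envelope.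
Qed.

End ParallelSurface.

Unset Implicit Arguments.

Theorem theorem2p1 (R : realType) (n : nat) (Omega : set 'rV[R]_n.+1)
    (rho : 'rV[R]_n.+1 -> R)
    (hOmega : sphere_domain Omega)
    (hrho : forall theta, Omega theta -> sphere_differentiable rho theta)
    (t : R) :
  parallel_surface Omega rho t = surface Omega (fun theta => rho theta + t).
Proof.
have th1 theta : Omega theta -> dotv theta theta = 1.
  by case: hOmega => _ [U _ ->] _ [/unit_sphereP].
by apply/seteqP; split=> _ [theta Oth <-]; exists theta => //; rewrite psi_Rmap //; exact: th1.
Qed.
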